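(* There is a set $\mathcal{H}$ of at most four bipartite graphs, namely $\mathcal{H}=\{P_5', P_6, H_{3,4}^1, P_7\}$ (defined in the context), such that the following holds. For every strongly acyclic bipartite graph $H$ such that neither $H$ nor its bipartite complement $H'$ is in $\mathcal{H}$, there is a positive constant $c=c(H)$ such that $\tilde{h}(n,H)\ge cn$ for all positive integers $n$.
   Context: All graphs are finite. A bipartite graph $G=((U,V),E)$ comes with a fixed ordered pair of parts (top part $U$, bottom part $V$), both nonempty, and $E\subseteq U\times V$. Its bipartite complement is $G'=((U,V),(U\times V)\setminus E)$. A bipartite graph $H$ is strongly acyclic if neither $H$ nor $H'$ contains a cycle. For a bipartite graph $G=((U,V),E)$, $\tilde\omega(G)$ is the largest integer $t$ such that there are $A\subseteq U$, $B\subseteq V$ with $|A|=|B|=t$ and $ab\in E$ for all $a\in A,b\in B$; $\tilde\alpha(G)$ is the largest integer $t$ such that there are $A\subseteq U$, $B\subseteq V$ with $|A|=|B|=t$ and $ab\notin E$ for all $a\in A$, $b\in B$. Let $\tilde h(G)=\max\{\tilde\alpha(G),\tilde\omega(G)\}$. A copy of $H=((X,Y),E_H)$ in $G=((U,V),E)$ is an induced copy respecting sides: injections $\phi:X\to U$ and $\psi:Y\to V$ with $xy\in E_H$ if and only if $\phi(x)\psi(y)\in E$, for all $x\in X$, $y\in Y$. $G$ is $H$-free if it contains no copy of $H$. $\mathrm{Forb}(n,H)$ is the set of all $H$-free bipartite graphs with both parts of size $n$, and $\tilde h(n,H)=\min\{\tilde h(G): G\in \mathrm{Forb}(n,H)\}$.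 The four graphs: $P_5'$ has parts $\{u_1,u_2,u_3\}$, $\{v_1,v_2,v_3\}$ and edges $u_1v_1,u_1v_2,u_2v_2,u_2v_3$ (here the prime is part of the name and does not denote a bipartite complement); $P_6$ is the path on 6 vertices, with parts of size 3 and 3; $H^1_{3,4}$ has parts $\{u_1,u_2,u_3\}$, $\{v_1,v_2,v_3,v_4\}$ and edges $u_1v_1,u_2v_1,u_2v_2,u_2v_3,u_3v_3,u_3v_4$; $P_7$ is the path on 7 vertices, with parts of size 3 and 4. Membership in $\mathcal{H}$ is up to isomorphism of bipartitioned graphs, where an isomorphism maps the two parts onto the two parts and may interchange the top and bottom parts. *)

(* Defs.v *)
From HB Require Import structures.
From mathcomp Require Import all_boot all_order all_algebra.
From mathcomp Require Import boolp reals.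

Set Implicit Arguments.
Unset Strict Implicit.
Unset Printing Implicit Defensive.

Record bigraph := Bigraph {
  top : finType;
  bot : finType;
  edge : top -> bot -> bool;
  top_gt0 : 0 < #|top|;
  bot_gt0 : 0 < #|bot|
}.

Definition bicompl (G : bigraph) : bigraph :=
  Bigraph (fun (u : top G) (v : bot G) => ~~ edge u v) (top_gt0 G) (bot_gt0 G).

Definition biswap (G : bigraph) : bigraph :=
  Bigraph (fun (v : bot G) (u : top G) => edge u v) (bot_gt0 G) (top_gt0 G).

Definition adj (G : bigraph) : rel (top G + bot G) := fun x y =>
  match x, y with
  | inl u, inr v => edge u v
  | inr v, inl u => edge u v
  | _, _ => false
  end.

(* The length bound excludes the empty sequence and an edge walked back and
   forth, both of which satisfy [ucycle]. *)
Definition acyclic (G : bigraph) : Prop :=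
  forall p : seq (top G + bot G), 2 < size p -> ~ ucycle (@adj G) p.

Definition strongly_acyclic (H : bigraph) : Prop :=
  acyclic H /\ acyclic (bicompl H).

Definition has_biclique (G : bigraph) (t : nat) : bool :=
  [exists A : {set top G}, exists B : {set bot G},
    [&& #|A| == t, #|B| == t & [forall a in A, forall b in B, edge a b]]].

Definition has_bihole (G : bigraph) (t : nat) : bool :=
  [exists A : {set top G}, exists B : {set bot G},
    [&& #|A| == t, #|B| == t & [forall a in A, forall b in B, ~~ edge a b]]].

(* The range t <= #|top G| loses nothing since t = #|A|, and t = 0 always
   qualifies. *)
Definition omega_tilde (G : bigraph) : nat :=
  \max_(t < #|top G|.+1 | has_biclique G t) t.

Definition alpha_tilde (G : bigraph) : nat :=
  \max_(t < #|top G|.+1 | has_bihole G t) t.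

Definition h_tilde (G : bigraph) : nat := maxn (alpha_tilde G) (omega_tilde G).

Definition has_copy (H G : bigraph) : bool :=
  [exists phi : {ffun top H -> top G}, exists psi : {ffun bot H -> bot G},
    [&& injectiveb phi, injectiveb psi &
        [forall x, forall y, edge x y == edge (phi x) (psi y)]]].

Definition Forb (n : nat) (H G : bigraph) : Prop :=
  [/\ #|top G| = n, #|bot G| = n & ~~ has_copy H G].

Definition h_value (n : nat) (H : bigraph) : pred nat :=
  fun t => `[< exists2 G, Forb n H G & h_tilde G = t >].

(* The value 0 is a placeholder for an empty [Forb n H], which occurs only for
   n = 0, as no bigraph has empty parts; see [h_forbP]. *)
Definition h_forb (n : nat) (H : bigraph) : nat :=
  if pselect (exists t, h_value n H t) is left ex then ex_minn ex else 0.

Lemma Forb_nonempty (n : nat) (H : bigraph) :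
  0 < n -> exists G, Forb n H G.
Proof.
move=> n0; have I0 : 0 < #|'I_n| by rewrite card_ord.
have /card_gt0P[x _] := top_gt0 H; have /card_gt0P[y _] := bot_gt0 H.
exists (Bigraph (fun _ _ : 'I_n => ~~ edge x y) I0 I0).
split; rewrite ?card_ord //; apply/negP => /existsP[phi /existsP[psi]].
case/and3P=> _ _ /forallP/(_ x)/forallP/(_ y) /=.
by case: (edge x y).
Qed.

Lemma h_forbP (n : nat) (H : bigraph) : 0 < n ->
  (exists2 G, Forb n H G & h_tilde G = h_forb n H) /\
  (forall G, Forb n H G -> h_forb n H <= h_tilde G).
Proof.
move=> n0; rewrite /h_forb; case: pselect => [ex|nex].
  case: ex_minnP => m /asboolP Hm min; split=> // G FG.
  by apply: min; apply/asboolP; exists G.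
have [G FG] := Forb_nonempty H n0.
by case: nex; exists (h_tilde G); apply/asboolP; exists G.
Qed.

Definition biiso_sides (G H : bigraph) : Prop :=
  exists (phi : top G -> top H) (psi : bot G -> bot H),
    [/\ bijective phi, bijective psi &
        forall x y, edge x y = edge (phi x) (psi y)].

Definition biiso (G H : bigraph) : Prop :=
  biiso_sides G H \/ biiso_sides (biswap G) H.

Lemma ordS_gt0 (n : nat) : 0 < #|'I_n.+1|.
Proof. by rewrite card_ord. Qed.

(* Parts {u_1, ..., u_(m+1)} and {v_1, ..., v_(n+1)}; the pair (i, j) in s,
   with indices starting from 1, stands for the edge u_i v_j. *)
Definition of_edges (m n : nat) (s : seq (nat * nat)) : bigraph :=
  @Bigraph 'I_m.+1 'I_n.+1 (fun i j => (i.+1, j.+1) \in s)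
    (ordS_gt0 m) (ordS_gt0 n).

(* The prime belongs to the name: this is not a bipartite complement. *)
Definition P5' : bigraph := of_edges 2 2 [:: (1, 1); (1, 2); (2, 2); (2, 3)].

(* u_1 v_1 u_2 v_2 u_3 v_3 *)
Definition P6 : bigraph :=
  of_edges 2 2 [:: (1, 1); (2, 1); (2, 2); (3, 2); (3, 3)].

Definition H34_1 : bigraph :=
  of_edges 2 3 [:: (1, 1); (2, 1); (2, 2); (2, 3); (3, 3); (3, 4)].

(* v_1 u_1 v_2 u_2 v_3 u_3 v_4 *)
Definition P7 : bigraph :=
  of_edges 2 3 [:: (1, 1); (1, 2); (2, 2); (2, 3); (3, 3); (3, 4)].

Definition calH : seq bigraph := [:: P5'; P6; H34_1; P7].

Definition in_calH (G : bigraph) : Prop :=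
  exists2 i, i < size calH & biiso G (nth P5' calH i).

(* Main.v *)
Require Import Defs.
From HB Require Import structures.
From mathcomp Require Import all_boot all_order all_algebra.
From mathcomp Require Import boolp reals zify.

Set Implicit Arguments.
Unset Strict Implicit.
Unset Printing Implicit Defensive.

(** The exceptional graphs absorb every strongly acyclic graph with at least
three vertices on each side, so that only graphs H with a side of size at most
two need a linear bound.

Indeed, let k and l be the sizes of the sides of a strongly acyclic H. Then H
and its bipartite complement are two forests on k + l vertices that share out
the k l edges of the complete bipartite graph, hence k l <= 2 (k + l - 1)
([strongly_acyclic_size]), that is (k - 2) (l - 2) <= 2. If k, l >= 3 this
leaves the sizes (3,3), (3,4) and (4,3). These are settled by inspecting all
zero-one tables with three columns: the tables without a monochromatic cycle of
length four or six are, up to relabelling, swapping sides and complementation,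
those of the four exceptional graphs ([strongly_acyclic_in_calH]).

Suppose now that H has at most two top vertices, exchanging sides if need be,
and that m bounds the sizes of its sides. As neither H nor its complement
contains a four-cycle, at most one bottom vertex of H is adjacent to both top vertices and at most one to neither.
So H embeds as soon as G has top vertices u, w whose neighbourhoods N(u), N(w)
meet, do not cover the bottom part, and have at least m elements in each of
the two differences ([copy_of_good_pair]). If G is H-free there is no such good
pair. Fix a bottom vertex v; after complementing G if necessary, at least half
of the top vertices miss v, so that no two of their neighbourhoods cover the
bottom part. Any two of these neighbourhoods are then disjoint, or one of them
is contained in the other up to fewer than m elements: the family is nearly
laminar. If half of the sets of this family contain more than half of the
bottom part, these pairwise intersect, and the smallest one is nearly contained
in all others. Otherwise half of them are small, and a greedy decomposition
into blocks, each nearly contained in its largest member, yields linearly many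
neighbourhoods nearly contained in a set X that misses at least half of the
bottom part ([laminar_block]). In both cases one finds linearly large A and B
such that each vertex of A has at most m neighbours, or each at most m
non-neighbours, in B; keeping t vertices of A, with (m + 1) t <= |B|, and
deleting from B their few neighbours, or non-neighbours, gives a homogeneous pair of linear size
([empty_pair_of_sparse]). *)

(** * Sizes of strongly acyclic graphs *)

Section Forest.
Variables (T : finType) (r : rel T).
Hypotheses (rsym : symmetric r) (rirr : irreflexive r).
Hypothesis racyc : forall p : seq T, 2 < size p -> ~ ucycle r p.

(** If every vertex of A had two neighbours in A, a path inside A could always
be prolonged at its head x: x has a neighbour in A other than the next vertex of
the path, and this neighbour cannot lie on the path, since it would close a
cycle. *)
Lemma acyclic_leaf (A : {set T}) : A != set0 ->
  exists2 x, x \in A & #|[set y in A | r x y]| <= 1.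
Proof.
case/set0Pn=> x0 x0A.
case: (pselect (exists2 x, x \in A & #|[set y in A | r x y]| <= 1)) => // noleaf.
have deg2 x : x \in A -> 1 < #|[set y in A | r x y]|.
  by move=> xA; rewrite ltnNge; apply/negP => le1; apply: noleaf; exists x.
have long n : exists x p,
    [/\ size p = n, path r x p, uniq (x :: p) & {subset x :: p <= A}].
  elim: n => [|n [x [p [szp pathp uniqp subA]]]].
    by exists x0, [::]; split=> // z; rewrite inE => /eqP->.
  have xA : x \in A by apply: subA; rewrite mem_head.
  (* For the path reduced to x, [head x p] is x, not a neighbour of x. *)
  have [y [yA rxy y_hd]] : exists y, [/\ y \in A, r x y & y != head x p].
    have /card_gt1P[y [z [+ + nyz]]] := deg2 _ xA.
    rewrite !inE => /andP[yA rxy] /andP[zA rxz].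
    have [ey|] := eqVneq y (head x p); last by exists y.
    by exists z; rewrite -ey eq_sym.
  have nyx : y != x by apply: contraTneq rxy => ->; rewrite rirr.
  have [yp|yNp] := boolP (y \in p); last first.
    exists y, (x :: p); split=> //=.
    - by rewrite szp.
    - by rewrite rsym rxy.
    - by move: uniqp => /= /andP[-> ->]; rewrite inE negb_or nyx yNp.
    - by move=> z; rewrite inE => /orP[/eqP->|/subA].
  case/splitPr: yp y_hd pathp uniqp {szp subA} => [[|z p1] p2].
    by rewrite eqxx.
  move=> _ pathp uniqp; case: (racyc (p := x :: rcons (z :: p1) y)).
    by rewrite /= size_rcons.
  apply/andP; split.
    rewrite /cycle rcons_path last_rcons (rsym y) rxy andbT.
    by move: pathp; rewrite -cat_rcons cat_path => /andP[].
  by move: uniqp; rewrite -cat_rcons -cat_cons cat_uniq => /andP[].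
have [x [p [szp _ uniqp _]]] := long #|T|.
by have := max_card [in x :: p]; rewrite (card_uniqP uniqp) /= szp ltnn.
Qed.

(** A forest on A has at most |A| - 1 edges, each of them counted twice here. *)
Lemma acyclic_degree_sum (A : {set T}) : A != set0 ->
  \sum_(x in A) #|[set y in A | r x y]| + 2 <= 2 * #|A|.
Proof.
have [n] := ubnP #|A|; elim: n A => // n IHn A ltAn A0.
have [x xA degx] := acyclic_leaf A0.
have cA : #|A| = #|A :\ x|.+1 by rewrite (cardsD1 x A) xA.
rewrite (big_setD1 x) //=.
have dropx y : #|[set z in A | r y z]| = r y x + #|[set z in A :\ x | r y z]|.
  rewrite (cardsD1 x) inE xA; congr (_ + #|pred_of_set _|).
  by apply/setP=> z; rewrite !inE andbA.
under eq_bigr => y _ do rewrite dropx.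
rewrite big_split /=.
have -> : \sum_(y in A :\ x) (r y x : nat) = #|[set y in A | r x y]|.
  rewrite -sum1_card big_mkcond [RHS]big_mkcond /=.
  apply: eq_bigr => y _; rewrite !inE rsym.
  by have [->|] := eqVneq y x; rewrite ?rirr ?andbF //=; case: (y \in A); case: (r x y).
have [Ax0|Ax0] := eqVneq (A :\ x) set0; last first.
  by have := IHn _ _ Ax0; rewrite cA in ltAn *; lia.
rewrite dropx Ax0 cA Ax0 !big_set0 rirr cards0.
by rewrite (eq_card0 (A := [set z in set0 | r x z])) // => z; rewrite !inE.
Qed.
End Forest.

Lemma adj_sym (H : bigraph) : symmetric (@adj H).
Proof. by case=> [x|x] [y|y]. Qed.

Lemma adj_irr (H : bigraph) : irreflexive (@adj H).
Proof. by case. Qed.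

Lemma degree_bicompl (H : bigraph) (z : top H + bot H) :
  #|[set w in [set: top H + bot H] | adj z w]|
    + #|[set w in [set: top H + bot H] | @adj (bicompl H) z w]|
  = if z is inl _ then #|bot H| else #|top H|.
Proof.
have inj_l : injective (inl : top H -> top H + bot H) by move=> ? ? [].
have inj_r : injective (inr : bot H -> top H + bot H) by move=> ? ? [].
case: z => [x|y].
- rewrite -[RHS]cardsT -(card_imset _ inj_r) -[RHS](cardsID [set w | adj (inl x) w]).
  congr (_ + _); apply: eq_card => -[x'|y'];
    rewrite !inE ?(mem_imset _ _ inj_r) ?inE ?andbT //= ?andbF //;
    by apply/esym/imsetP => -[].
- rewrite -[RHS]cardsT -(card_imset _ inj_l) -[RHS](cardsID [set w | adj (inr y) w]).
  congr (_ + _); apply: eq_card => -[x'|y'];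
    rewrite !inE ?(mem_imset _ _ inj_l) ?inE ?andbT //= ?andbF //;
    by apply/esym/imsetP => -[].
Qed.

Lemma strongly_acyclic_size (H : bigraph) : strongly_acyclic H ->
  #|top H| * #|bot H| + 2 <= 2 * (#|top H| + #|bot H|).
Proof.
move=> [acH acH'].
have T0 : [set: top H + bot H] != set0.
  by have /card_gt0P[x _] := top_gt0 H; apply/set0Pn; exists (inl x); rewrite inE.
have S1 := acyclic_degree_sum (adj_sym (H := H)) (adj_irr (H := H)) acH T0.
have S2 := acyclic_degree_sum (adj_sym (H := bicompl H))
  (adj_irr (H := bicompl H)) acH' T0.
have : \sum_(z in [set: top H + bot H])
   (#|[set w in [set: top H + bot H] | adj z w]|
     + #|[set w in [set: top H + bot H] | @adj (bicompl H) z w]|)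
   = 2 * (#|top H| * #|bot H|).
  under eq_bigr => z _ do rewrite degree_bicompl.
  rewrite (eq_bigl predT) => [|z]; last by rewrite inE.
  rewrite big_sumType /= !sum_nat_const.
  rewrite !(@eq_card _ xpredT predT) //.
  by rewrite [X in _ + X]mulnC addnn mul2n.
rewrite big_split /=.
have := cardsT (top H + bot H)%type; rewrite card_sum => cT.
rewrite cT in S1; rewrite /= cT in S2.
move=> e; have := leq_add S1 S2; rewrite addnACA e /=.
lia.
Qed.

(** * Short cycles and the exceptional graphs *)

Lemma biswap_acyclic (H : bigraph) : acyclic H -> acyclic (biswap H).
Proof.
pose sw (z : bot H + top H) : top H + bot H :=
  match z with inl y => inr y | inr x => inl x end.
have sw_inj : injective sw by move=> [?|?] [?|?] //= [->].
move=> acH p szp /andP[cyc uniqp]; apply: (acH (map sw p)); rewrite ?size_map //.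
apply/andP; split; last by rewrite map_inj_uniq.
by rewrite cycle_map; apply: sub_cycle cyc => -[?|?] [?|?].
Qed.

Lemma biswap_strongly_acyclic (H : bigraph) :
  strongly_acyclic H -> strongly_acyclic (biswap H).
Proof.
case=> acH acH'; split; first exact: biswap_acyclic.
exact: (@biswap_acyclic (bicompl H)).
Qed.

Lemma no_mono_C4 (H : bigraph) c (x x' : top H) (y y' : bot H) :
  strongly_acyclic H -> x != x' ->
  edge x y = c -> edge x y' = c -> edge x' y = c -> edge x' y' = c -> y = y'.
Proof.
move=> [acH acH'] nx xy xy' x'y x'y'; apply/eqP/negPn/negP => ny.
have uniqC : uniq [:: inl x; inr y; inl x'; inr y'].
  by rewrite /= !inE !(inj_eq inl_inj) !(inj_eq inr_inj) (negbTE nx) (negbTE ny).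
case: c xy xy' x'y x'y' => xy xy' x'y x'y';
  [apply: (acH _ _ (introT andP (conj _ uniqC)))
  |apply: (acH' _ _ (introT andP (conj _ uniqC)))] => //=;
  by rewrite xy xy' x'y x'y'.
Qed.

Lemma no_mono_C6 (H : bigraph) c (x0 x1 x2 : top H) (y0 y1 y2 : bot H) :
  strongly_acyclic H -> uniq [:: x0; x1; x2] -> uniq [:: y0; y1; y2] ->
  edge x0 y0 = c -> edge x1 y0 = c -> edge x1 y1 = c -> edge x2 y1 = c ->
  edge x2 y2 = c -> edge x0 y2 = c -> False.
Proof.
move=> [acH acH'] ux uy e00 e10 e11 e21 e22 e02.
have uniqC : uniq [:: inl x0; inr y0; inl x1; inr y1; inl x2; inr y2].
  move: ux uy; rewrite /= !inE !(inj_eq inl_inj) !(inj_eq inr_inj) /=.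
  by rewrite !negb_or !andbT => /andP[/andP[-> ->] ->] /andP[/andP[-> ->] ->].
case: c e00 e10 e11 e21 e22 e02 => e00 e10 e11 e21 e22 e02;
  [apply: (acH _ _ (introT andP (conj _ uniqC)))
  |apply: (acH' _ _ (introT andP (conj _ uniqC)))] => //=;
  by rewrite e00 e10 e11 e21 e22 e02.
Qed.

Fixpoint words (A : Type) (s : seq A) n : seq (seq A) :=
  if n is n'.+1 then [seq a :: w | a <- s, w <- words s n'] else [:: [::]].

Definition table (A B : Type) (f : A -> B -> bool) xs ys : seq (seq bool) :=
  [seq [seq f x y | x <- xs] | y <- ys].

Definition mono (c : bool) (ij : nat * nat) (w : seq bool) :=
  (nth false w ij.1 == c) && (nth false w ij.2 == c).

(** The rows of M stand for bottom vertices, the positions 0, 1, 2 for the top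
ones. The first condition excludes four-cycles of colour c: no two rows share two
positions of colour c. The second one excludes six-cycles whose three bottom
vertices have exactly two neighbours of colour c; when there is no four-cycle,
the rows of a six-cycle of colour c are of this kind. *)
Definition free_of_short_cycles (c : bool) (M : seq (seq bool)) : bool :=
  pairwise (fun w w' => all (fun ij => ~~ (mono c ij w && mono c ij w'))
    [:: (0, 1); (0, 2); (1, 2)]) M &&
  ~~ all (mem M) [:: [:: c; c; ~~ c]; [:: c; ~~ c; c]; [:: ~~ c; c; c]].

(** The adjacency of the graph with edge list [es], possibly complemented and
possibly with exchanged sides, on labels starting from 0. *)
Definition pattern (es : seq (nat * nat)) (neg swp : bool) : nat -> nat -> bool :=
  fun i j => neg (+) ((if swp then (j.+1, i.+1) else (i.+1, j.+1)) \in es).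

Definition is_pattern (M : seq (seq bool)) es neg swp : bool :=
  has (fun I => has (fun J => M == table (pattern es neg swp) I J)
    (permutations (iota 0 (size M)))) (permutations (iota 0 3)).

Definition classified (candidates : seq (seq (nat * nat) * bool * bool)) l :=
  all (fun M => (free_of_short_cycles true M && free_of_short_cycles false M)
        ==> has (fun k => is_pattern M k.1.1 k.1.2 k.2) candidates)
    (words (words [:: true; false] 3) l).

Definition P5'_edges := [:: (1, 1); (1, 2); (2, 2); (2, 3)].
Definition P6_edges := [:: (1, 1); (2, 1); (2, 2); (3, 2); (3, 3)].
Definition H34_1_edges := [:: (1, 1); (2, 1); (2, 2); (2, 3); (3, 3); (3, 4)].
Definition P7_edges := [:: (1, 1); (1, 2); (2, 2); (2, 3); (3, 3); (3, 4)].

Lemma mem_words (A : eqType) (s w : seq A) :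
  {subset w <= s} -> w \in words s (size w).
Proof.
elim: w => // a w IHw sub /=; apply/allpairsP; exists (a, w); split=> //=.
  by apply: sub; rewrite mem_head.
by apply: IHw => b bw; apply: sub; rewrite inE bw orbT.
Qed.

Lemma table_free_of_short_cycles (H : bigraph) c x0 x1 x2 ys :
  strongly_acyclic H -> uniq [:: x0; x1; x2] -> uniq ys ->
  free_of_short_cycles c (table (@edge H) [:: x0; x1; x2] ys).
Proof.
move=> acH ux uys; apply/andP; split.
  rewrite pairwise_map; move: uys; rewrite uniq_pairwise.
  apply: sub_pairwise => y y' /= ny; rewrite /mono /= andbT.
  move: ux; rewrite /= !inE negb_or => /andP[/andP[n01 n02] /andP[n12 _]].
  apply/and3P; split; apply/negP => /andP[/andP[/eqP a /eqP b] /andP[/eqP a' /eqP b']].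
  - by case/eqP: ny; apply: (no_mono_C4 acH n01 a a' b b').
  - by case/eqP: ny; apply: (no_mono_C4 acH n02 a a' b b').
  - by case/eqP: ny; apply: (no_mono_C4 acH n12 a a' b b').
apply/negP; rewrite /= andbT => /and3P[].
case/mapP=> y01 _ [a0 a1 a2]; case/mapP=> y02 _ [b0 b1 b2].
case/mapP=> y12 _ [c0 c1 c2].
apply: (no_mono_C6 (y0 := y01) (y1 := y12) (y2 := y02) (c := c) acH ux) => //.
rewrite /= !inE andbT negb_or; apply/andP; split; first (apply/andP; split).
- by apply/eqP=> E; move: a0; rewrite E -c0; case: (c).
- by apply/eqP=> E; move: a1; rewrite E -b1; case: (c).
- by apply/eqP=> E; move: c0; rewrite E -b0; case: (c).
Qed.

(** Equal tables give isomorphic graphs: the bijections send a vertex to the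
label found at the same position. *)
Lemma table_bijections (H : bigraph) f m n xs ys I J :
  uniq xs -> xs =i top H -> uniq ys -> ys =i bot H ->
  perm_eq I (iota 0 m.+1) -> perm_eq J (iota 0 n.+1) ->
  size xs = m.+1 -> size ys = n.+1 ->
  table (@edge H) xs ys = table f I J ->
  exists (phi : top H -> 'I_m.+1) (psi : bot H -> 'I_n.+1),
    [/\ bijective phi, bijective psi & forall x y, edge x y = f (phi x) (psi y)].
Proof.
have label (T : finType) (s : seq T) k K : uniq s -> s =i T ->
    perm_eq K (iota 0 k.+1) -> size s = k.+1 ->
    exists2 h : T -> 'I_k.+1, bijective h & forall x, nth 0 K (index x s) = h x.
  move=> us sT pK szs.
  have szK : size K = k.+1 by rewrite (perm_size pK) size_iota.
  have uK : uniq K by rewrite (perm_uniq pK) iota_uniq.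
  have ltK x : index x s < size K by rewrite szK -szs index_mem sT.
  have ltn x : nth 0 K (index x s) < k.+1.
    by have := mem_nth 0 (ltK x); rewrite (perm_mem pK) mem_iota.
  exists (fun x => Ordinal (ltn x)) => //.
  apply: inj_card_bij.
    move=> x y [] /eqP; rewrite nth_uniq // => /eqP E.
    by apply: (index_inj x) E; rewrite sT.
  by rewrite card_ord -szs -(card_uniqP us) (eq_card sT).
move=> uxs xsT uys ysT pI pJ szx szy tab.
have [phi bphi phiE] := label _ _ _ _ uxs xsT pI szx.
have [psi bpsi psiE] := label _ _ _ _ uys ysT pJ szy.
exists phi, psi; split=> // x y.
have szI : size I = m.+1 by rewrite (perm_size pI) size_iota.
have szJ : size J = n.+1 by rewrite (perm_size pJ) size_iota.
have xi : index x xs < size xs by rewrite index_mem xsT.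
have yi : index y ys < size ys by rewrite index_mem ysT.
have := congr1 (fun M => nth false (nth [::] M (index y ys)) (index x xs)) tab.
rewrite /= !(nth_map y) ?(nth_map 0) ?(nth_map x) ?szI ?szJ -?szx -?szy //.
by rewrite !nth_index ?xsT ?ysT // phiE psiE.
Qed.

Definition patterns_3_3 :=
  [seq (p, swp) | p <- [seq (es, neg) | es <- [:: P5'_edges; P6_edges],
                                        neg <- [:: false; true]],
                  swp <- [:: false; true]].

(** Exchanging sides matters here because of P5': its isolated vertex lies on a
prescribed side. Lazy evaluation avoids searching for a relabelling of the many
tables that have a short cycle. *)
Lemma classified3 : classified patterns_3_3 3.
Proof. by lazy. Qed.

(** Neither complements nor swaps occur: both graphs are isomorphic to their
bipartite complements, and the sizes of their sides differ. *)
Lemma classified4 :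
  classified [:: (H34_1_edges, false, false); (P7_edges, false, false)] 4.
Proof. by lazy. Qed.

Lemma pattern_of_strongly_acyclic (H : bigraph) pats n :
  classified pats n.+1 -> strongly_acyclic H -> #|top H| = 3 -> #|bot H| = n.+1 ->
  exists2 k, k \in pats & exists (phi : top H -> 'I_3) (psi : bot H -> 'I_n.+1),
    [/\ bijective phi, bijective psi &
        forall x y, edge x y = pattern k.1.1 k.1.2 k.2 (phi x) (psi y)].
Proof.
move=> /allP cls acH topH botH.
have uxs := enum_uniq (top H); have uys := enum_uniq (bot H).
have xsT : enum (top H) =i top H by move=> x; rewrite mem_enum.
have ysT : enum (bot H) =i bot H by move=> y; rewrite mem_enum.
have szx : size (enum (top H)) = 3 by rewrite -cardE.
have szy : size (enum (bot H)) = n.+1 by rewrite -cardE.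
set xs := enum (top H) in uxs xsT szx; set ys := enum (bot H) in uys ysT szy.
pose M := table (@edge H) xs ys.
have szM : size M = n.+1 by rewrite size_map.
have Mwords : M \in words (words [:: true; false] 3) n.+1.
  rewrite -szM; apply: mem_words => w /mapP[y _ ->].
  rewrite -szx -(size_map (fun x => edge x y)); apply: mem_words => b _.
  by rewrite !inE; case: b.
have free c : free_of_short_cycles c M.
  rewrite /M; case: xs szx uxs {xsT Mwords M szM} => [|x0 [|x1 [|x2 []]]] //= _ uxs.
  exact: table_free_of_short_cycles.
move: (cls _ Mwords); rewrite !free => /hasP[k kpats].
case/hasP=> I; rewrite mem_permutations => pI /hasP[J].
rewrite szM mem_permutations => pJ /eqP tab.
exists k => //; exact: (table_bijections uxs xsT uys ysT pI pJ).
Qed.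

Lemma in_calH_biswap (H : bigraph) : in_calH (biswap H) -> in_calH H.
Proof. by case=> i ilt [iso|iso]; exists i => //; [right | left]. Qed.

Lemma strongly_acyclic_in_calH (H : bigraph) : strongly_acyclic H ->
  2 < #|top H| -> #|top H| <= #|bot H| -> in_calH H \/ in_calH (bicompl H).
Proof.
move=> acH top3 le_tb.
have := strongly_acyclic_size acH.
have [botH|neq3] := eqVneq #|bot H| 3.
  move=> _; have topH : #|top H| = 3 by lia.
  have [[[es neg] swp]] := pattern_of_strongly_acyclic classified3 acH topH botH.
  move=> kpats [phi [psi [bphi bpsi edgeE]]].
  have [i ilt esE] : exists2 i, i < size calH & nth P5' calH i = of_edges 2 2 es.
    have : all (fun k => k.1.1 \in [:: P5'_edges; P6_edges]) patterns_3_3 by [].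
    move/allP/(_ _ kpats) => /=.
    by rewrite !inE => /orP[] /eqP->; [exists 0 | exists 1].
  case: neg swp {kpats} edgeE => -[] edgeE; [right|right|left|left];
    exists i => //; rewrite esE; [right|left|right|left];
    [exists psi, phi|exists phi, psi|exists psi, phi|exists phi, psi]; split=> // x y;
    by rewrite /= edgeE /pattern /= ?negbK ?addFb.
move=> le_prod; have topH : #|top H| = 3 by nia.
have botH : #|bot H| = 4 by lia.
left; have [k kpats [phi [psi [bphi bpsi edgeE]]]] :=
  pattern_of_strongly_acyclic classified4 acH topH botH.
move: kpats edgeE; rewrite !inE => /orP[] /eqP-> edgeE.
  by exists 2 => //; left; exists phi, psi; split.
by exists 3 => //; left; exists phi, psi; split.
Qed.

(** * Nearly laminar neighbourhoods *)

Definition nonedge (T S : Type) (e : T -> S -> bool) u v := ~~ e u v.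

Definition empty_pair (T S : finType) (e : T -> S -> bool) t : Prop :=
  exists (A : {set T}) (B : {set S}),
    [/\ #|A| = t, #|B| = t & forall a b, a \in A -> b \in B -> ~~ e a b].

Lemma subset_of_card (T : finType) (A : {set T}) t : t <= #|A| ->
  exists2 A' : {set T}, A' \subset A & #|A'| = t.
Proof.
case/card_geqP=> s [uniqs <- sA]; exists [set x in s].
  by apply/subsetP=> x; rewrite inE => /sA.
by rewrite cardsE (card_uniqP uniqs).
Qed.

Section LaminarFamilies.
Variables (T S : finType).
Implicit Types (e : T -> S -> bool) (u w : T) (A W R : {set T}) (B X : {set S}).

Definition nbr e u : {set S} := [set v | e u v].

(** The pairs that contain every H with two top vertices, at most m bottom
vertices of each of the kinds (1,0) and (0,1), and at most one of each of the
kinds (1,1) and (0,0). *)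
Definition good_pair e m u w : bool :=
  [&& m <= #|nbr e u :\: nbr e w|, m <= #|nbr e w :\: nbr e u|,
      [exists v, e u v && e w v] & [exists v, ~~ e u v && ~~ e w v]].

Lemma good_pair_compl e m u w : good_pair (nonedge e) m u w = good_pair e m u w.
Proof.
have nbrC u' w' : nbr (nonedge e) u' :\: nbr (nonedge e) w' = nbr e w' :\: nbr e u'.
  by apply/setP=> v; rewrite !inE negbK andbC.
rewrite /good_pair !nbrC; under [X in [&& _, _, _ & X]]eq_existsb => v do rewrite !negbK.
by rewrite [in RHS]andbCA; congr [&& _, _ & _]; rewrite andbC.
Qed.

(** Take any t vertices of A: together they spoil at most t m vertices of B. *)
Lemma empty_pair_of_sparse e m t A B :
  (forall u, u \in A -> #|nbr e u :&: B| <= m) ->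
  t <= #|A| -> m.+1 * t <= #|B| -> empty_pair e t.
Proof.
move=> sparse /subset_of_card[A' /subsetP sA' cA'] leB.
pose Y := \bigcup_(u in A') (nbr e u :&: B).
have leY : #|Y| <= t * m.
  rewrite -cA' -sum_nat_const /Y.
  elim/big_rec2: _ => [|u k Z uA' leZ]; first by rewrite cards0.
  by apply: leq_trans (leq_card_setU _ _) (leq_add _ leZ); apply/sparse/sA'.
have /subset_of_card[B' /subsetP sB' cB'] : t <= #|B :\: Y|.
  have := cardsID Y B; have := subset_leq_card (subsetIr B Y).
  by move: leY leB; lia.
exists A', B'; split=> // a b aA' bB'.
have /sB' := bB'; rewrite inE => /andP[bNY bB].
by apply: contra bNY => ab; apply/bigcupP; exists a; rewrite // !inE ab.
Qed.

(** Greedily move blocks from the remaining family R to the collected family A: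
a block C consists of the members of R nearly contained in the largest
neighbourhood N(r) of R, and all neighbourhoods left in R are disjoint from N(r)
and hence from the union X of the N(r) used so far. Stop as soon as A contains a
quarter of W. Either X is then small and A is the block sought; or X is large,
and the neighbourhoods left in R avoid it, hence lie in its small complement, so
that R works if it still contains a quarter of W; or else the last block
was so large that it works by itself, with X := N(r). *)
Lemma laminar_block e m W : 0 < m ->
  (forall u w, u \in W -> w \in W ->
     [|| #|nbr e u :\: nbr e w| < m, #|nbr e w :\: nbr e u| < m
       | [disjoint nbr e u & nbr e w]]) ->
  (forall u, u \in W -> 2 * #|nbr e u| <= #|S|) ->
  exists A X, [/\ #|W| <= 4 * #|A|, 2 * #|X| <= #|S| &
                  forall u, u \in A -> #|nbr e u :\: X| < m].
Proof.
move=> m0 laminar low.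
have [W0|W0] := posnP #|W|.
  by exists set0, set0; rewrite W0 !cards0 muln0; split=> // u; rewrite inE.
suff greedy k A X R : #|R| <= k -> R \subset W -> W \subset A :|: R ->
    4 * #|A| < #|W| -> (forall u, u \in A -> #|nbr e u :\: X| < m) ->
    (forall u, u \in R -> [disjoint nbr e u & X]) ->
    exists A X, [/\ #|W| <= 4 * #|A|, 2 * #|X| <= #|S| &
                  forall u, u \in A -> #|nbr e u :\: X| < m].
  apply: (greedy #|W| set0 set0 W) => // [|||u _].
  - exact: subsetUr.
  - by rewrite cards0 muln0.
  - by move=> u; rewrite inE.
  - by rewrite disjoint_sym disjoints_subset sub0set.
elim: k A X R => [|k IHk] A X R leRk RW WAR ltA inA outR.
  by have := leq_trans (subset_leq_card WAR) (leq_card_setU A R); lia.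
have leW := leq_trans (subset_leq_card WAR) (leq_card_setU A R).
have /card_gt0P[r0 r0R] : 0 < #|R| by lia.
have [r rR rmax] := arg_maxnP (fun u => #|nbr e u|) r0R.
pose C := [set u in R | #|nbr e u :\: nbr e r| < m].
have CR : C \subset R by apply/subsetP=> u; rewrite inE => /andP[].
have rW : r \in W by apply: (subsetP RW).
have inC u : u \in C -> #|nbr e u :\: nbr e r| < m by rewrite inE => /andP[].
have outC u : u \in R :\: C -> [disjoint nbr e u & nbr e r].
  rewrite !inE => /andP[+ uR]; rewrite uR /= => Nur.
  have /or3P[lt|lt|//] := laminar u r (subsetP RW _ uR) rW.
    by rewrite lt in Nur.
  case/negP: Nur; apply: leq_ltn_trans lt.
  by rewrite !cardsD setIC leq_sub2r //; apply: rmax.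
have C0 : 0 < #|C|.
  by apply/card_gt0P; exists r; rewrite !inE setDv cards0 m0 andbT.
have cR : #|R| = #|C| + #|R :\: C|.
  by rewrite -(cardsID C R) (setIidPr CR).
have inAC u : u \in A :|: C -> #|nbr e u :\: (X :|: nbr e r)| < m.
  rewrite inE => /orP[/inA|/inC]; apply: leq_ltn_trans; apply/subset_leq_card/setDS.
    exact: subsetUl.
  exact: subsetUr.
have outAC u : u \in R :\: C -> [disjoint nbr e u & X :|: nbr e r].
  move=> uRC; have /setDP[uR _] := uRC.
  by rewrite -setI_eq0 setIUr setU_eq0 !setI_eq0 outR ?outC.
have cAC : #|A :|: C| <= #|A| + #|C| := leq_card_setU A C.
have [ltAC|leAC] := ltnP (4 * #|A :|: C|) #|W|.
  apply: (IHk (A :|: C) (X :|: nbr e r) (R :\: C)) => //.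
  - by lia.
  - exact: subset_trans (subsetDl _ _) RW.
  apply: subset_trans WAR _; apply/subsetP=> u.
  by rewrite !(in_setU, in_setD); case: (u \in A); case: (u \in C).
have [lowX|highX] := leqP (2 * #|X :|: nbr e r|) #|S|.
  by exists (A :|: C), (X :|: nbr e r).
have [leRC|ltRC] := leqP #|W| (4 * #|R :\: C|).
  exists (R :\: C), (~: (X :|: nbr e r)); split=> //.
    by have := cardsC (X :|: nbr e r); lia.
  move=> u /outAC; rewrite setDE setCK disjoint_sym -setI_eq0 setIC => /eqP->.
  by rewrite cards0.
exists C, (nbr e r); split=> //; last exact: low.
lia.
Qed.

(** The constant 16: half of the top part misses v, half of those have small
(or large) neighbourhoods, and a block contains a quarter of these. *)
Lemma homogeneous_pair_of_cononneighbor e m t (v : S) : 0 < m -> #|T| = #|S| ->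
  (forall u w, ~~ good_pair e m u w) ->
  #|T| <= 2 * #|[set u | ~~ e u v]| -> 16 * m.+1 * t <= #|T| ->
  empty_pair e t \/ empty_pair (nonedge e) t.
Proof.
move=> m0 eqTS no_good; set W := [set u | _] => leW le_t.
have laminar u w : u \in W -> w \in W ->
    [|| #|nbr e u :\: nbr e w| < m, #|nbr e w :\: nbr e u| < m
      | [disjoint nbr e u & nbr e w]].
  rewrite !inE => uv wv; have := no_good u w.
  rewrite /good_pair !negb_and -!ltnNge => /or4P[-> //|->|/existsPn com|].
  - by rewrite orbT.
  - rewrite -setI_eq0; apply/or3P/Or33/eqP/setP=> v'.
    by rewrite !inE; apply: negbTE.
  - by case/existsP; exists v; rewrite uv wv.
(* Members of W with small neighbourhoods, and with large ones. *)
pose L := [set u in W | 2 * #|nbr e u| <= #|S|].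
pose U := W :\: L.
have cW : #|W| = #|L| + #|U|.
  by rewrite -(cardsID L W) (setIidPr _) //; apply/subsetP=> u; rewrite inE => /andP[].
have [leL|ltL] := leqP #|W| (2 * #|L|).
  left; have [||A [X [leA leX sparse]]] := @laminar_block e m L m0.
  - move=> u w; rewrite !(in_set (fun _ => _ && _)) => /andP[uW _] /andP[wW _].
    exact: laminar.
  - by move=> u; rewrite inE => /andP[].
  apply: (@empty_pair_of_sparse e m t A (~: X)).
  - by move=> u /sparse; rewrite setDE => /ltnW.
  - by move: le_t; lia.
  - by have := cardsC X; move: le_t; lia.
(* Two large neighbourhoods intersect, so that the smallest one is nearly
   contained in every other. *)
right.
have /card_gt0P[r0 r0U] : 0 < #|U| by lia.
have [r rU rmin] := arg_minnP (fun u => #|nbr e u|) r0U.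
have highU u : u \in U -> u \in W /\ #|S| < 2 * #|nbr e u|.
  by case/setDP=> uW; rewrite inE uW -ltnNge.
have [rW highr] := highU _ rU.
apply: (@empty_pair_of_sparse (nonedge e) m t U (nbr e r)).
- move=> u uU; have [uW high] := highU _ uU.
  have -> : nbr (nonedge e) u :&: nbr e r = nbr e r :\: nbr e u.
    by apply/setP=> v'; rewrite !inE.
  have /or3P[/ltnW//|lt|dis] := laminar r u rW uW.
    apply/ltnW; apply: leq_ltn_trans lt.
    by rewrite !cardsD setIC leq_sub2r //; apply: rmin.
  have := max_card (nbr e r :|: nbr e u).
  by rewrite cardsU (disjoint_setI0 dis) cards0; lia.
- by move: le_t; lia.
- by move: le_t; lia.
Qed.

(** Some half of the top part either misses v or is adjacent to v; in the second
case exchange edges and non-edges, which preserves good pairs. *)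
Lemma homogeneous_pair_of_no_good_pair e m t : 0 < #|S| -> 0 < m -> #|T| = #|S| ->
  (forall u w, ~~ good_pair e m u w) -> 16 * m.+1 * t <= #|T| ->
  empty_pair e t \/ empty_pair (nonedge e) t.
Proof.
move=> /card_gt0P[v _] m0 eqTS no_good le_t.
have [le1|lt1] := leqP #|T| (2 * #|[set u | ~~ e u v]|).
  exact: (homogeneous_pair_of_cononneighbor m0 eqTS no_good le1).
have [||||] := @homogeneous_pair_of_cononneighbor (nonedge e) m t v m0 eqTS.
- by move=> u w; rewrite good_pair_compl.
- have := cardsC [set u | ~~ e u v]; rewrite (_ : ~: _ = [set u | ~~ nonedge e u v]).
    by lia.
  by apply/setP=> u; rewrite !inE.
- exact: le_t.
- by right.
- case=> A [B [cA cB AB]]; left; exists A, B; split=> // a b aA bB.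
  by have := AB a b aA bB; rewrite /nonedge negbK.
Qed.
End LaminarFamilies.

(** * Graphs with a side of size at most two *)

(** A bottom vertex y of H is sent to a bottom vertex of G related to u and w as
y is to the two top vertices of H. The differences of the neighbourhoods of u and
w are large enough to separate the vertices y adjacent to exactly one top vertex;
each of the two other kinds has at most one vertex, by the absence of
four-cycles. *)
Lemma copy_of_good_pair (H G : bigraph) m (u w : top G) :
  strongly_acyclic H -> #|top H| <= 2 -> #|bot H| <= m ->
  good_pair (@edge G) m u w -> has_copy H G.
Proof.
move=> acH top2 le_m /and4P[le_uw le_wu /existsP[v11 /andP[u11 w11]]].
case/existsP=> v00 /andP[u00 w00].
have /card_gt0P[x1 _] := top_gt0 H.
(* Row of the second top vertex. If there is none, an imaginary second row
opposite to the first one makes the two constant kinds empty. *)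
pose e2 y := if [pick x | x != x1] is Some x2 then @edge H x2 y else ~~ edge x1 y.
have e2E x y : x != x1 -> edge x y = e2 y.
  rewrite /e2; case: pickP => [x2 nx2|/(_ x) ->] // nx.
  have [-> //|nxx2] := eqVneq x x2.
  have : #|x |: [set x1; x2]| <= 2 by apply: leq_trans (max_card _) top2.
  by rewrite cardsU1 !inE (negbTE nx) (negbTE nxx2) cards2 eq_sym nx2.
have e2_inj c y y' : edge x1 y = c -> e2 y = c -> edge x1 y' = c -> e2 y' = c -> y = y'.
  rewrite /e2; case: pickP => [x2 nx2|_] a b a' b'; last by move: b; rewrite a; case: (c).
  by rewrite eq_sym in nx2; apply: (no_mono_C4 acH nx2 a a' b b').
pose only (a b : top G) := enum (nbr (@edge G) a :\: nbr (@edge G) b).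
pose psi y := match edge x1 y, e2 y with
  | true, true => v11
  | false, false => v00
  | true, false => nth v00 (only u w) (enum_rank y)
  | false, true => nth v00 (only w u) (enum_rank y)
  end.
have rank_lt (a b : top G) (y : bot H) : m <= #|nbr (@edge G) a :\: nbr (@edge G) b| ->
    enum_rank y < size (only a b).
  by rewrite /only -cardE; apply: leq_trans; apply: leq_trans le_m; apply: ltn_ord.
have onlyP (a b : top G) (y : bot H) : m <= #|nbr (@edge G) a :\: nbr (@edge G) b| ->
    let v := nth v00 (only a b) (enum_rank y) in ~~ edge b v /\ edge a v.
  move=> le_ab; have := mem_nth v00 (rank_lt a b y le_ab).
  by rewrite mem_enum !inE => /andP[].
have psi_u y : edge u (psi y) = edge x1 y.
  rewrite /psi; case: (edge x1 y); case: (e2 y) => //; last exact: negbTE.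
    by have [] := onlyP u w y le_uw.
  by have [/negbTE] := onlyP w u y le_wu.
have psi_w y : edge w (psi y) = e2 y.
  rewrite /psi; case: (edge x1 y); case: (e2 y) => //; last exact: negbTE.
    by have [/negbTE] := onlyP u w y le_uw.
  by have [] := onlyP w u y le_wu.
have nuw : u != w.
  apply: contraTneq le_uw => ->; rewrite setDv cards0 -ltnNge.
  exact: leq_trans (bot_gt0 H) le_m.
apply/existsP; exists [ffun x => if x == x1 then u else w].
apply/existsP; exists [ffun y => psi y]; apply/and3P; split.
- apply/injectiveP=> x x'; rewrite !ffunE.
  case: eqVneq => [->|nx]; case: eqVneq => [->|nx'] // E.
  + by rewrite E eqxx in nuw.
  + by rewrite E eqxx in nuw.
  have : #|x |: [set x'; x1]| <= 2 by apply: leq_trans (max_card _) top2.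
  by rewrite cardsU1 !inE (negbTE nx) cards2 nx' orbF; case: eqVneq.
- apply/injectiveP=> y y'; rewrite !ffunE => E.
  have E1 : edge x1 y = edge x1 y' by rewrite -!psi_u E.
  have E2 : e2 y = e2 y' by rewrite -!psi_w E.
  move: E; rewrite /psi -E1 -E2.
  case E1y: (edge x1 y); case E2y: (e2 y) => E;
    try by apply: e2_inj; rewrite -?E1 -?E2 ?E1y ?E2y.
  + move/eqP: E; rewrite nth_uniq ?enum_uniq ?rank_lt //.
    by move/eqP/ord_inj/enum_rank_inj.
  + move/eqP: E; rewrite nth_uniq ?enum_uniq ?rank_lt //.
    by move/eqP/ord_inj/enum_rank_inj.
- apply/forallP=> x; apply/forallP=> y; rewrite !ffunE.
  by have [->|nx] := eqVneq x x1; rewrite ?psi_u ?psi_w ?(e2E _ _ nx).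
Qed.

Lemma has_copy_biswap (H G : bigraph) : has_copy (biswap H) (biswap G) -> has_copy H G.
Proof.
case/existsP=> psi /existsP[phi /and3P[inj_psi inj_phi /forallP edgeE]].
apply/existsP; exists phi; apply/existsP; exists psi; apply/and3P; split=> //.
by apply/forallP=> x; apply/forallP=> y; exact: (forallP (edgeE y) x).
Qed.

Lemma empty_pair_transpose (T S : finType) (e : T -> S -> bool) t :
  empty_pair (fun v u => e u v) t -> empty_pair e t.
Proof. by case=> A [B [cA cB AB]]; exists B, A; split=> // b a bB aA; apply: AB. Qed.

Lemma h_tilde_ge (G : bigraph) t :
  empty_pair (@edge G) t \/ empty_pair (nonedge (@edge G)) t -> t <= h_tilde G.
Proof.
have max_ge (P : pred nat) : t <= #|top G| -> P t ->
    t <= \max_(s < #|top G|.+1 | P s) s.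
  by rewrite -ltnS => lt_t Pt; apply: (@leq_bigmax_cond _ _ _ (Ordinal lt_t)).
case=> -[A [B [cA cB AB]]]; rewrite leq_max; apply/orP; [left | right].
all: apply: max_ge; first by rewrite -cA max_card.
all: apply/existsP; exists A; apply/existsP; exists B; rewrite cA cB !eqxx /=.
all: apply/forall_inP=> a aA; apply/forall_inP=> b bB; have := AB a b aA bB => //.
by rewrite /nonedge negbK.
Qed.

Lemma h_tilde_gt0 (G : bigraph) : 0 < h_tilde G.
Proof.
have /card_gt0P[a _] := top_gt0 G; have /card_gt0P[b _] := bot_gt0 G.
apply: h_tilde_ge; case ab: (edge a b); [right | left];
  exists [set a], [set b]; rewrite !cards1; split=> // a' b' /set1P-> /set1P->;
  by rewrite /nonedge ab.
Qed.

Lemma h_tilde_linear (H G : bigraph) m n t :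
  strongly_acyclic H -> minn #|top H| #|bot H| <= 2 -> #|top H| <= m -> #|bot H| <= m ->
  Forb n H G -> 16 * m.+1 * t <= n -> t <= h_tilde G.
Proof.
move=> acH; rewrite geq_min => small topm botm [topG botG noH] le_t.
have m0 : 0 < m := leq_trans (top_gt0 H) topm.
apply: h_tilde_ge; case/orP: small => small.
  apply: homogeneous_pair_of_no_good_pair m0 _ _ _; rewrite ?topG ?botG //.
  - by rewrite -botG bot_gt0.
  - by move=> u w; apply: contra noH; apply: copy_of_good_pair.
have [] : empty_pair (@edge (biswap G)) t \/ empty_pair (nonedge (@edge (biswap G))) t.
- apply: homogeneous_pair_of_no_good_pair m0 _ _ _; rewrite ?topG ?botG //.
  + by rewrite -topG top_gt0.
  + move=> u w; apply: contra noH => good; apply: has_copy_biswap.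
    exact: copy_of_good_pair (biswap_strongly_acyclic acH) _ _ good.
- by left; apply: empty_pair_transpose.
- by right; apply: empty_pair_transpose.
Qed.

Import Order.TTheory GRing.Theory Num.Theory.
Local Open Scope ring_scope.

Theorem theorem1 (R : realType) :
  (size calH <= 4)%N /\
  forall H : bigraph,
    strongly_acyclic H ->
    ~ in_calH H -> ~ in_calH (bicompl H) ->
    exists c : R, 0 < c /\
      forall n : nat, (0 < n)%N -> c * n%:R <= (h_forb n H)%:R.
Proof.
split=> // H acH notH notH'.
have small : (minn #|top H| #|bot H| <= 2)%N.
  rewrite leqNgt; apply/negP; rewrite leq_min => /andP[top3 bot3].
  have [le_tb|/ltnW le_bt] := leqP #|top H| #|bot H|.
    by case: (strongly_acyclic_in_calH acH top3 le_tb).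
  case: (strongly_acyclic_in_calH (biswap_strongly_acyclic acH) bot3 le_bt).
    by move/in_calH_biswap.
  by move/(@in_calH_biswap (bicompl H)).
pose m := maxn #|top H| #|bot H|; pose K := (16 * m.+1)%N.
have K0 : 0 < (2 * K)%:R :> R by rewrite ltr0n.
exists (2 * K)%:R^-1; split; first by rewrite invr_gt0.
move=> n n0; have [[G FG <-] _] := h_forbP H n0.
rewrite mulrC ler_pdivrMr // -natrM ler_nat.
(* With q := n %/ K, both q and 1 bound h from below, so n < (q + 1) K <= 2 K h. *)
have := h_tilde_linear (t := n %/ K) acH small (leq_maxl _ _) (leq_maxr _ _) FG.
rewrite mulnC leq_trunc_div => /(_ isT).
have := h_tilde_gt0 G; have := ltn_ceil n (d := K) isT.
by set q := (n %/ K)%N; nia.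
Qed.
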